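(* Let $\Delta$ be an additive subgroup of $\mathbb{C}$, let $b,c\in\mathbb{C}$ with $b\neq0$, and let $\varphi:\Delta\to\mathbb{C}^+$ be a group homomorphism. Let $CL_3(b,\varphi,c)=\bigoplus_{\alpha\in\Delta,\,i\in\mathbb{N}}\mathbb{C}[\partial]x_{\alpha,i}$ be the Lie conformal algebra, free as a $\mathbb{C}[\partial]$-module on $\{x_{\alpha,i}\mid\alpha\in\Delta,\ i\in\mathbb{N}\}$, with the $\lambda$-bracket $$\begin{aligned}[{x_{\alpha,i}}_\lambda x_{\beta,j}]={}&\partial\big((\alpha+b)x_{\alpha+\beta,i+j}+i\,x_{\alpha+\beta,i+j-1}\big)\\&+\lambda\big((\alpha+\beta+2b)x_{\alpha+\beta,i+j}+(i+j)x_{\alpha+\beta,i+j-1}\big)\\&+\frac1b\big((\beta+b)\varphi(\alpha)-(\alpha+b)\varphi(\beta)\big)x_{\alpha+\beta,i+j}\\&+\frac1b\big[j(\varphi(\alpha)-c(\alpha+b))+i(c(\beta+b)-\varphi(\beta))\big]x_{\alpha+\beta,i+j-1}\end{aligned}$$ for all $\alpha,\beta\in\Delta$ and $i,j\in\mathbb{N}$. Then $CL_3(b,\varphi,c)$ is a simple Lie conformal algebra.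
   Context: $\mathbb{N}=\{0,1,2,\dots\}$ and $\mathbb{C}^+$ denotes the additive group of $\mathbb{C}$. A Lie conformal algebra is a $\mathbb{C}[\partial]$-module $R$ with a $\mathbb{C}$-bilinear $\lambda$-bracket $[\cdot_\lambda\cdot]:R\times R\to R[\lambda]=R\otimes\mathbb{C}[\lambda]$ such that for all $a,b,c\in R$: $[\partial a_\lambda b]=-\lambda[a_\lambda b]$ and $[a_\lambda\partial b]=(\lambda+\partial)[a_\lambda b]$; $[a_\lambda b]=-[b_{-\lambda-\partial}a]$; $[a_\lambda[b_\mu c]]=[[a_\lambda b]_{\lambda+\mu}c]+[b_\mu[a_\lambda c]]$. For subspaces $A,B\subset R$, $[A,B]$ is the $\mathbb{C}$-linear span of all coefficients (in powers of $\lambda$) of $[a_\lambda b]$, $a\in A$, $b\in B$. An ideal of $R$ is a $\mathbb{C}[\partial]$-submodule $I\subset R$ with $[R,I]\subset I$. $R$ is abelian if $[R,R]=0$, and simple if it is not abelian and its only ideals are $0$ and $R$. The $\lambda$-bracket given on the generators extends to the whole module by the identities $[\partial a_\lambda b]=-\lambda[a_\lambda b]$, $[a_\lambda\partial b]=(\lambda+\partial)[a_\lambda b]$. For $i=j=0$ the coefficients of $x_{\alpha+\beta,-1}$ vanish, so the symbol $x_{\alpha+\beta,-1}$ is read as $0$. *)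

(* Defs.v *)
From HB Require Import structures.
From mathcomp Require Import all_boot all_order all_algebra finmap.
From mathcomp Require Import classical_sets reals.
From mathcomp Require Export complex.
From mathcomp Require Import monalg.

Set Implicit Arguments.
Unset Strict Implicit.
Unset Printing Implicit Defensive.

Import GRing.Theory.
Local Open Scope ring_scope.

(* {malg M[I]} is the group of finitely supported families (m_k)_(k : I) in M, *)
(* i.e. of polynomials with coefficients in M and exponents in I; << m *g k >> *)
(* is the monomial m * X^k and p@_k is a coefficient.  The library turns it    *)
(* into a module only when M is a ring; polymod does so for a module M.        *)
Definition polymod (I : choiceType) (M : zmodType) : Type := {malg M[I]}.

HB.instance Definition _ (I : choiceType) (M : zmodType) :=
  GRing.Zmodule.copy (polymod I M) {malg M[I]}.

Section PolyModule.
Variables (A : nzRingType) (I : choiceType) (M : lmodType A).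
Implicit Types (p q : polymod I M) (a : A).

Definition pscale a p : polymod I M := \sum_(k <- msupp p) << a *: p@_k *g k >>.

Lemma pscaleE a p k : (pscale a p)@_k = a *: p@_k.
Proof.
rewrite [in RHS](monalgE p) /pscale !raddf_sum /=.
by apply: eq_bigr => l _; rewrite !mcoeffU scalerMnr.
Qed.

Lemma pscaleA a b p : pscale a (pscale b p) = pscale (a * b) p.
Proof. by apply/malgP => k; rewrite !pscaleE scalerA. Qed.

Lemma pscale1 : left_id 1 pscale.
Proof. by move=> p; apply/malgP => k; rewrite pscaleE scale1r. Qed.

Lemma pscaleDr : right_distributive pscale +%R.
Proof. by move=> a p q; apply/malgP => k; rewrite !(pscaleE, mcoeffD) scalerDr. Qed.

Lemma pscaleDl p : {morph pscale^~ p : a b / a + b}.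
Proof. by move=> a b; apply/malgP => k; rewrite !(pscaleE, mcoeffD) scalerDl. Qed.

HB.instance Definition _ := GRing.Zmodule_isLmodule.Build A (polymod I M)
  pscaleA pscale1 pscaleDr pscaleDl.

End PolyModule.

Notation "M '[lambda]'" := (polymod nat M)
  (at level 2, left associativity, format "M [lambda]") : type_scope.

(* << m *g (k, l) >> is m * lambda^k * mu^l *)
Notation "M '[lambda,mu]'" := (polymod (nat * nat)%type M)
  (at level 2, left associativity, format "M [lambda,mu]") : type_scope.

Section Substitution.
Variables (M V : zmodType).

Definition reindex (I : choiceType) (s : I -> I) (p : polymod I M) :
  polymod I M := \sum_(k <- msupp p) << p@_k *g s k >>.

(* For p = \sum_n lambda^n p_n, this is \sum_n T^n (f p_n): apply f to the     *)
(* coefficients of p and replace lambda by the operator T.                     *)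
Definition subst (T : V -> V) (f : M -> V) (p : M[lambda]) : V :=
  \sum_(n <- msupp p) iter n T (f p@_n).

End Substitution.

Section LieConformal.
Variables (K : fieldType) (M : lmodType {poly K}).

(* A K[d]-module is a module over {poly K}, with d acting as 'X and a scalar   *)
(* t : K acting as t%:P.                                                       *)
Definition mul_d (V : lmodType {poly K}) (v : V) : V := 'X *: v.

Definition const1 (m : M) : M[lambda] := << m *g 0%N >>.
Definition mul_lambda : M[lambda] -> M[lambda] := reindex S.

Definition const2 (m : M) : M[lambda,mu] := << m *g (0%N, 0%N) >>.
Definition mul_lambda2 : M[lambda,mu] -> M[lambda,mu] :=
  reindex (fun kl => (kl.1.+1, kl.2)).
Definition mul_mu2 : M[lambda,mu] -> M[lambda,mu] :=
  reindex (fun kl => (kl.1, kl.2.+1)).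

Variable br : M -> M -> M[lambda].

(* [b_(- lambda - d) a] *)
Definition br_flip (a b : M) : M[lambda] :=
  subst (fun p => - mul_lambda p - mul_d p) const1 (br b a).

(* [a_lambda [b_mu c]] *)
Definition br_lambda_mu (a b c : M) : M[lambda,mu] :=
  subst mul_mu2 (fun m => subst mul_lambda2 const2 (br a m)) (br b c).

(* [[a_lambda b]_(lambda + mu) c] *)
Definition br_sum (a b c : M) : M[lambda,mu] :=
  subst mul_lambda2
    (fun m => subst (fun p => mul_lambda2 p + mul_mu2 p) const2 (br m c))
    (br a b).

(* [b_mu [a_lambda c]] *)
Definition br_mu_lambda (a b c : M) : M[lambda,mu] :=
  subst mul_lambda2 (fun m => subst mul_mu2 const2 (br b m)) (br a c).

Record lie_conformal_algebra : Prop := LieConformalAlgebra {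
  br_linearl : forall (t : K) a a' b,
    br (t%:P *: a + a') b = t%:P *: br a b + br a' b;
  br_linearr : forall (t : K) a b b',
    br a (t%:P *: b + b') = t%:P *: br a b + br a b';
  br_dl : forall a b, br (mul_d a) b = - mul_lambda (br a b);
  br_dr : forall a b, br a (mul_d b) = mul_lambda (br a b) + mul_d (br a b);
  br_skew : forall a b, br a b = - br_flip a b;
  br_jacobi : forall a b c,
    br_lambda_mu a b c = br_sum a b c + br_mu_lambda a b c
}.

Local Open Scope classical_set_scope.

Definition lin_span (S : set M) : set M :=
  [set v | exists (n : nat) (t : 'I_n -> K) (s : 'I_n -> M),
     (forall i, S (s i)) /\ v = \sum_(i < n) (t i)%:P *: s i].

Definition br_span (A B : set M) : set M :=
  lin_span [set v | exists a b n, [/\ A a, B b & v = (br a b)@_n]].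

Definition submodule (I : set M) : Prop :=
  I 0 /\ forall (f : {poly K}) u v, I u -> I v -> I (f *: u + v).

Definition ideal (I : set M) : Prop :=
  submodule I /\ br_span setT I `<=` I.

Definition abelian_lca : Prop := br_span setT setT = [set 0].

Definition simple_lca : Prop :=
  ~ abelian_lca /\ forall I, ideal I -> I = [set 0] \/ I = setT.

End LieConformal.

Section Subgroup.
Variables (V : zmodType) (D : zmodClosed V).

Record subgroup : predArgType := Subgroup {
  sgval : V;
  _ : sgval \in D
}.

HB.instance Definition _ := [isSub for sgval].
HB.instance Definition _ := [Choice of subgroup by <:].
HB.instance Definition _ := [SubChoice_isSubZmodule of subgroup by <:].

End Subgroup.

Section CL3.
Variables (K : fieldType) (Delta : zmodClosed K).
Variables (b : K) (phi : {additive subgroup Delta -> K}) (c : K).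
Implicit Types (alpha beta : subgroup Delta) (i j : nat).

Definition cl3 : lmodType {poly K} := {malg {poly K}[(subgroup Delta * nat)%type]}.

Definition cl3_x alpha i : cl3 := << (alpha, i) >>.

(* x_(alpha, i - 1), with x_(alpha, -1) = 0 *)
Definition cl3_xpred alpha i : cl3 := if i is i'.+1 then cl3_x alpha i' else 0.

Definition cl3_br_gen alpha i beta j : cl3[lambda] :=
  let s := sgval alpha in
  let t := sgval beta in
  let x := cl3_x (alpha + beta) (i + j) in
  let x' := cl3_xpred (alpha + beta) (i + j) in
  mul_d (const1 ((s + b)%:P *: x + i%:R%:P *: x'))
  + mul_lambda (const1 ((s + t + b *+ 2)%:P *: x + (i + j)%:R%:P *: x'))
  + (b^-1 * ((t + b) * phi alpha - (s + b) * phi beta))%:P *: const1 x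
  + (b^-1 * (j%:R * (phi alpha - c * (s + b))
             + i%:R * (c * (t + b) - phi beta)))%:P *: const1 x'.

(* f(T) v *)
Definition op_eval (V : lmodType {poly K}) (f : {poly K}) (T : V -> V) (v : V) :
  V := \sum_(n < size f) (f`_n)%:P *: iter n T v.

(* [f(d) x_k _lambda g(d) x_l] = f(- lambda) g(lambda + d) [x_k _lambda x_l]   *)
Definition cl3_br (u v : cl3) : cl3[lambda] :=
  \sum_(k <- msupp u) \sum_(l <- msupp v)
    op_eval u@_k (fun p => - mul_lambda p)
      (op_eval v@_l (fun p => mul_lambda p + mul_d p)
         (cl3_br_gen k.1 k.2 l.1 l.2)).

Lemma cl3_br_genE alpha i beta j :
  cl3_br (cl3_x alpha i) (cl3_x beta j) = cl3_br_gen alpha i beta j.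
Proof.
rewrite /cl3_br /cl3_x !msuppU oner_eq0 !big_seq_fset1 !mcoeffUU /op_eval.
by rewrite size_poly1 !big_ord1 /= -!polyC1 !coefC /= !scale1r.
Qed.

End CL3.

(* Main.v *)
From HB Require Import structures.
Require Import Defs.
From mathcomp Require Import all_boot all_order all_algebra finmap.
From mathcomp Require Import boolp classical_sets reals complex.
From mathcomp Require Import monalg ring.

(**
  Write x_(alpha,i) as e^(alpha t) t^i, let A be the commutative algebra they
  span, D the derivative in t, E the derivation sending x_(alpha,i) to
  phi(alpha) x_(alpha,i) + c i x_(alpha,i-1), and let d stand for the
  indeterminate of C[d].  For x, y in A the bracket is
    [x_lambda y] = (D + b)x * (lambda + d - E/b)y + (lambda + E/b)x * (D + b)y,
  the Jacobian of the commuting operators D + b and d - E/b once d is read as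
  - lambda on x and lambda + d on y; this is why it satisfies the Lie axioms.
  They are checked after pairing with an arbitrary function h from the
  generators to a commutative ring B in which d, lambda, mu take values: the
  iterated brackets then become sums of explicit scalars, and the choice of a
  polynomial ring for B makes the pairings separate elements.

  For simplicity, let u <> 0 lie in an ideal J, with top d-coefficient y in A,
  in degree N.  The coefficient of lambda^(N+1) in [x_lambda u] is
  (D + 2b)(x y).  The y in A with (D + 2b)(x y) in J for all x in A form an
  ideal of A; applying the same remark to (D + 2b)y, of d-degree 0, shows that
  it is stable under D.  Since D is locally finite with eigenvectors the units
  e^(alpha t), this ideal contains 1, so J contains (D + 2b)A = A.
*)

Set Implicit Arguments.
Unset Strict Implicit.
Unset Printing Implicit Defensive.

Import GRing.Theory.
Local Open Scope ring_scope.

(** * Sums over a support as pairings with values in a commutative ring *)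

Section Mmap.
Variables (I : choiceType) (M : zmodType) (B : comNzRingType).

Lemma mmap_reindex (s : I -> I) (F : {additive M -> B}) (h : I -> B)
    (p : polymod I M) :
  mmap F h (Defs.reindex s p) = mmap F (fun k => h (s k)) p.
Proof.
rewrite /Defs.reindex raddf_sum [RHS]mmapE; apply: eq_bigr => k _.
exact: mmapU.
Qed.

Lemma eq_mmap (F F' : M -> B) h h' (p : {malg M[I]}) :
  F =1 F' -> h =1 h' -> mmap F h p = mmap F' h' p.
Proof. by move=> eF eh; apply: eq_bigr => k _; rewrite eF eh. Qed.

Lemma mmap_coefD (F : M -> B) h h' (p : {malg M[I]}) :
  mmap F (fun k => h k + h' k) p = mmap F h p + mmap F h' p.
Proof. by rewrite !mmapE -big_split; apply: eq_bigr => k _; rewrite mulrDr. Qed.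

Lemma mmap_coefM (F : M -> B) (t : B) h (p : {malg M[I]}) :
  mmap F (fun k => t * h k) p = t * mmap F h p.
Proof. by rewrite !mmapE mulr_sumr; apply: eq_bigr => k _; rewrite mulrCA. Qed.

Lemma mmap_coef0 (F : M -> B) (p : {malg M[I]}) : mmap F (fun=> 0) p = 0.
Proof. by rewrite mmapE big1 // => k _; rewrite mulr0. Qed.

Lemma mmap_exchange (J : choiceType) (N : zmodType) (F : M -> B) (F' : N -> B)
    (h : I -> J -> B) p (q : {malg N[J]}) :
  mmap F (fun k => mmap F' (h k) q) p
  = mmap F' (fun l => mmap F (h^~ l) p) q.
Proof.
rewrite !mmapE; under eq_bigr do rewrite mmapE mulr_sumr.
rewrite exchange_big; apply: eq_bigr => l _; rewrite mmapE mulr_sumr.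
by apply: eq_bigr => k _; rewrite mulrCA.
Qed.

(** Serves iterated brackets: when each coefficient of [p] is bracketed with a fixed [q], the
    summation over [q] moves to the outside. *)
Lemma mmap_exchangel (J : choiceType) (N : zmodType) (F : N -> B)
    (G : J -> M -> B) h (p : {malg M[I]}) (q : {malg N[J]}) :
  mmap (fun m => mmap F (G^~ m) q) h p = mmap F (fun l => mmap (G l) h p) q.
Proof.
rewrite !mmapE; under eq_bigr do rewrite mmapE mulr_suml.
rewrite exchange_big; apply: eq_bigr => l _; rewrite mmapE mulr_sumr.
by apply: eq_bigr => k _; rewrite mulrA.
Qed.

(** Once [F] turns the operator [T] into multiplication by [t], replacing lambda by [T] amounts to
    evaluating lambda at [t]. No additivity of [f] is assumed. *)
Lemma subst_mmap (V : zmodType) (F : {additive V -> B}) (T : V -> V) (t : B)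
    (f : M -> V) (p : M[lambda]) :
  (forall v, F (T v) = t * F v) ->
  F (subst T f p) = mmap (fun m => F (f m)) (fun n => t ^+ n) p.
Proof.
move=> FT; rewrite /subst raddf_sum mmapE; apply: eq_bigr => n _ /=.
(* The index of the coefficient of [p] is separated from the number of iterations, so that the
   induction changes only the latter. *)
elim: n {2 3}n => [|n IHn] m /=; first by rewrite mulr1.
by rewrite FT IHn mulrCA -exprS.
Qed.

End Mmap.

(** * Evaluating elements and brackets *)

Section Pairing.
Variables (K : fieldType) (G : choiceType) (B : comNzRingType).
Variable (iota : {rmorphism K -> B}).
Local Notation M := {malg {poly K}[G]}.
Implicit Types (d lam mu : B) (h : G -> B).

Definition ev d : {poly K} -> B := horner_eval d \o map_poly iota.
HB.instance Definition _ d := GRing.RMorphism.on (ev d).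

Lemma evX d : ev d 'X = d.
Proof. by rewrite /ev /= map_polyX /horner_eval hornerX. Qed.

Lemma evC d t : ev d t%:P = iota t.
Proof. by rewrite /ev /= map_polyC /horner_eval hornerC. Qed.

Lemma evM d : {morph ev d : f g / f * g}.
Proof. exact: rmorphM. Qed.

Lemma evE d (f : {poly K}) : ev d f = \sum_(n < size f) iota f`_n * d ^+ n.
Proof.
rewrite -[f in LHS]coefK poly_def raddf_sum; apply: eq_bigr => n _.
by rewrite -mul_polyC /= evM evC rmorphXn /= evX.
Qed.

(* [d], [lam] and [mu] are the values given to the indeterminates d, lambda   *)
(* and mu, and [h] gives the values of the generators.                        *)
Definition pair0 d h : M -> B := mmap (ev d) h.
HB.instance Definition _ d h := GRing.Additive.on (pair0 d h).

Definition pair1 lam d h : M[lambda] -> B :=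
  mmap (pair0 d h) (fun n => lam ^+ n).
HB.instance Definition _ lam d h := GRing.Additive.on (pair1 lam d h).

Definition pair2 lam mu d h : M[lambda,mu] -> B :=
  mmap (pair0 d h) (fun kl => lam ^+ kl.1 * mu ^+ kl.2).
HB.instance Definition _ lam mu d h := GRing.Additive.on (pair2 lam mu d h).

Lemma pair0Z d h (f : {poly K}) (u : M) :
  pair0 d h (f *: u) = ev d f * pair0 d h u.
Proof.
rewrite malgZ_def /fgscale raddf_sum /pair0 [in RHS]mmapE mulr_sumr.
by apply: eq_bigr => k _ /=; rewrite [LHS]mmapU /= evM mulrA.
Qed.

Lemma pair1Z lam d h (f : {poly K}) (p : M[lambda]) :
  pair1 lam d h (f *: p) = ev d f * pair1 lam d h p.
Proof.
rewrite {1}/GRing.scale /= /pscale raddf_sum /pair1 [in RHS]mmapE mulr_sumr.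
by apply: eq_bigr => k _ /=; rewrite [LHS]mmapU /= pair0Z mulrA.
Qed.

Lemma pair1_lambda lam d h (p : M[lambda]) :
  pair1 lam d h (mul_lambda p) = lam * pair1 lam d h p.
Proof.
rewrite /pair1 mmap_reindex -mmap_coefM; apply: eq_mmap => // n /=.
by rewrite exprS.
Qed.

Lemma pair1_d lam d h (p : M[lambda]) :
  pair1 lam d h (mul_d p) = d * pair1 lam d h p.
Proof. by rewrite pair1Z evX. Qed.

Lemma pair1_const lam d h m : pair1 lam d h (const1 m) = pair0 d h m.
Proof. by rewrite /pair1 [LHS]mmapU mulr1. Qed.

Lemma pair2_lambda lam mu d h (p : M[lambda,mu]) :
  pair2 lam mu d h (mul_lambda2 p) = lam * pair2 lam mu d h p.
Proof.
rewrite /pair2 mmap_reindex -mmap_coefM; apply: eq_mmap => // n /=.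
by rewrite exprS mulrA.
Qed.

Lemma pair2_mu lam mu d h (p : M[lambda,mu]) :
  pair2 lam mu d h (mul_mu2 p) = mu * pair2 lam mu d h p.
Proof.
rewrite /pair2 mmap_reindex -mmap_coefM; apply: eq_mmap => // n /=.
by rewrite exprS mulrCA.
Qed.

Lemma pair2_const lam mu d h m : pair2 lam mu d h (const2 m) = pair0 d h m.
Proof. by rewrite /pair2 [LHS]mmapU !mulr1. Qed.

Lemma pair2_subst lam mu d h T t (p : M[lambda]) :
    (forall q, pair2 lam mu d h (T q) = t * pair2 lam mu d h q) ->
  pair2 lam mu d h (subst T (@const2 _ M) p) = pair1 t d h p.
Proof.
move=> /subst_mmap->; apply: eq_mmap => // m; exact: pair2_const.
Qed.

Lemma pair1_op_eval lam d h T t (f : {poly K}) (p : M[lambda]) :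
    (forall q, pair1 lam d h (T q) = t * pair1 lam d h q) ->
  pair1 lam d h (op_eval f T p) = ev t f * pair1 lam d h p.
Proof.
move=> HT; rewrite /op_eval raddf_sum evE mulr_suml; apply: eq_bigr => n _ /=.
rewrite pair1Z evC -mulrA; congr (_ * _).
elim: {n}(n : nat) => [|n IHn] /=; first by rewrite mul1r.
by rewrite HT IHn mulrA exprS.
Qed.

End Pairing.

(** * Pairings in polynomial rings separate elements *)

Section Separation.
Variables (K : fieldType) (G : choiceType).
Local Notation M := {malg {poly K}[G]}.

(** In [{poly {poly K}}] the inner variable plays d and the outer one lambda. *)
Definition iota1 : K -> {poly {poly K}} := polyC \o polyC.
HB.instance Definition _ := GRing.RMorphism.on iota1.
(** From the inside out, the three variables play d, lambda and mu. *)
Definition iota2 : K -> {poly {poly {poly K}}} := polyC \o iota1.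
HB.instance Definition _ := GRing.RMorphism.on iota2.

Lemma ev_iota1 (f : {poly K}) : ev iota1 'X%:P f = f%:P.
Proof.
rewrite evE -[f in RHS]coefK poly_def raddf_sum; apply: eq_bigr => n _.
by rewrite -mul_polyC /= rmorphM rmorphXn.
Qed.

Lemma ev_iota2 (f : {poly K}) : ev iota2 'X%:P%:P f = f%:P%:P.
Proof.
rewrite evE -[f in RHS]coefK poly_def !raddf_sum; apply: eq_bigr => n _.
by rewrite -mul_polyC /= !rmorphM !rmorphXn.
Qed.

Lemma pair0_delta (B : comNzRingType) (iota : {rmorphism K -> B}) d k (u : M) :
  pair0 iota d (fun l => (l == k)%:R) u = ev iota d u@_k.
Proof.
rewrite [in RHS](monalgE u) !raddf_sum /pair0 mmapE; apply: eq_bigr => l _.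
by rewrite /= mcoeffU raddfMn mulr_natr.
Qed.

(** With [h] the indicator of a generator [k], the pairing is a polynomial in lambda whose
    coefficients are the components on [k]; it therefore recovers every coefficient. *)
Lemma pair1_inj (p q : M[lambda]) :
  (forall h, pair1 iota1 'X 'X%:P h p = pair1 iota1 'X 'X%:P h q) -> p = q.
Proof.
move=> epq; suff coefP (r : M[lambda]) n k :
    r@_n@_k = (pair1 iota1 'X 'X%:P (fun l => (l == k)%:R) r)`_n.
  by apply/malgP=> n; apply/malgP=> k; rewrite !coefP epq.
rewrite {1}(monalgE r) /pair1 mmapE coef_sum !raddf_sum.
apply: eq_bigr => m _ /=; rewrite mcoeffU pair0_delta ev_iota1.
by rewrite coefCM coefXn eq_sym mcoeffMn mulr_natr.
Qed.

Lemma pair2_inj (p q : M[lambda,mu]) :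
  (forall h, pair2 iota2 'X%:P 'X 'X%:P%:P h p
     = pair2 iota2 'X%:P 'X 'X%:P%:P h q) -> p = q.
Proof.
move=> epq; suff coefP (r : M[lambda,mu]) n k :
    r@_n@_k
    = (pair2 iota2 'X%:P 'X 'X%:P%:P (fun l => (l == k)%:R) r)`_n.2`_n.1.
  by apply/malgP=> n; apply/malgP=> k; rewrite !coefP epq.
rewrite {1}(monalgE r) /pair2 mmapE !coef_sum !raddf_sum.
apply: eq_bigr => m _ /=; rewrite mcoeffU pair0_delta ev_iota2.
rewrite !coefCM -rmorphXn /= coefCM coefXn mulr_natr coefMn coefXn.
rewrite mcoeffMn -pair_eqE /= [n.1 == _]eq_sym [n.2 == _]eq_sym.
by do 2!case: eqP => _; rewrite ?mulr1 ?mulr0.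
Qed.

End Separation.

(** * The bracket as a scalar kernel, and the identities of the kernel *)

Section CL3Pairing.
Variables (K : fieldType) (Delta : zmodClosed K).
Variables (b : K) (phi : {additive subgroup Delta -> K}) (c : K).
Variables (B : comNzRingType) (iota : {rmorphism K -> B}).
Local Notation G := (subgroup Delta * nat)%type.
Local Notation M := (cl3 Delta).
Local Notation br := (cl3_br b phi c).
Implicit Types (lam mu d : B) (h : G -> B) (k l : G).

Definition at_pred h (alpha : subgroup Delta) (i : nat) : B :=
  if i is i'.+1 then h (alpha, i') else 0.

(** This is the scalar that [x_k _lambda x_l] becomes under [h]. Iterated brackets nest it, the
    outer bracket supplying the [h] of the inner one. *)
Definition kernel lam d k l h : B :=
  let s := sgval k.1 in let t := sgval l.1 in
  let i := k.2 in let j := l.2 in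
  (d * iota (s + b) + lam * iota (s + t + b *+ 2)
   + iota (b^-1 * ((t + b) * phi k.1 - (s + b) * phi l.1)))
    * h (k.1 + l.1, (i + j)%N)
  + (d * i%:R + lam * (i + j)%:R
     + iota (b^-1 * (j%:R * (phi k.1 - c * (s + b))
             + i%:R * (c * (t + b) - phi l.1))))
    * at_pred h (k.1 + l.1) (i + j).

Lemma pair0_x d h k : pair0 iota d h (cl3_x k.1 k.2) = h k.
Proof.
by rewrite /pair0 /cl3_x -surjective_pairing [LHS]mmapU /= rmorph1 mul1r.
Qed.

Lemma pair0_xpred d h alpha i :
  pair0 iota d h (cl3_xpred alpha i) = at_pred h alpha i.
Proof. by case: i => [|i]; rewrite ?raddf0 // (pair0_x _ _ (alpha, i)). Qed.

Lemma pair0_comb d h (s t : K) (x y : M) :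
  pair0 iota d h (s%:P *: x + t%:P *: y)
  = iota s * pair0 iota d h x + iota t * pair0 iota d h y.
Proof.
by rewrite raddfD /= [X in X + _ = _]pair0Z [X in _ + X = _]pair0Z !evC.
Qed.

Lemma pair1_gen lam d h k l :
  pair1 iota lam d h (cl3_br_gen b phi c k.1 k.2 l.1 l.2) = kernel lam d k l h.
Proof.
transitivity
  (d * (iota (sgval k.1 + b) * h (k.1 + l.1, (k.2 + l.2)%N)
        + k.2%:R * at_pred h (k.1 + l.1) (k.2 + l.2))
   + lam * (iota (sgval k.1 + sgval l.1 + b *+ 2) * h (k.1 + l.1, (k.2 + l.2)%N)
        + (k.2 + l.2)%:R * at_pred h (k.1 + l.1) (k.2 + l.2))
   + iota (b^-1 * ((sgval l.1 + b) * phi k.1 - (sgval k.1 + b) * phi l.1))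
       * h (k.1 + l.1, (k.2 + l.2)%N)
   + iota (b^-1 * (l.2%:R * (phi k.1 - c * (sgval k.1 + b))
                   + k.2%:R * (c * (sgval l.1 + b) - phi l.1)))
       * at_pred h (k.1 + l.1) (k.2 + l.2)); last by rewrite /kernel; ring.
have x_val := pair0_x d h (k.1 + l.1, (k.2 + l.2)%N).
have x'_val := pair0_xpred d h (k.1 + l.1) (k.2 + l.2).
rewrite /cl3_br_gen 3!(raddfD (pair1 iota lam d h)) /=; congr (_ + _ + _ + _).
- by rewrite [LHS]pair1_d pair1_const pair0_comb x_val x'_val rmorph_nat.
- by rewrite [LHS]pair1_lambda pair1_const pair0_comb x_val x'_val rmorph_nat.
- by rewrite [LHS]pair1Z evC pair1_const x_val.
- by rewrite [LHS]pair1Z evC pair1_const x'_val.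
Qed.

(** By sesquilinearity, d acts as - lambda on the left argument and as lambda + d on the right one,
    so [u] and [v] are paired at these two values. *)
Lemma pair1_br lam d h (u v : M) :
  pair1 iota lam d h (br u v) =
  pair0 iota (- lam)
    (fun k => pair0 iota (lam + d) (fun l => kernel lam d k l h) v) u.
Proof.
rewrite /cl3_br raddf_sum /pair0 [RHS]mmapE; apply: eq_bigr => k _ /=.
rewrite raddf_sum mmapE mulr_sumr; apply: eq_bigr => l _ /=.
rewrite (@pair1_op_eval _ _ _ _ _ _ _ _ (- lam)); last first.
  by move=> q; rewrite raddfN /= pair1_lambda mulNr.
rewrite (@pair1_op_eval _ _ _ _ _ _ _ _ (lam + d)) ?pair1_gen //.
by move=> q; rewrite raddfD /= pair1_lambda pair1_d mulrDl.
Qed.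

Lemma kernel_skew lam d h k l :
  kernel lam d k l h = - kernel (- lam - d) d l k h.
Proof.
rewrite /kernel [l.1 + _]addrC [(l.2 + _)%N]addnC !natrD; ring.
Qed.

(** The inner bracket is evaluated at the value of d dictated by its slot: lambda + d or mu + d on
    the right, - (lambda + mu) on the left. What remains is a polynomial identity. *)
Lemma kernel_jacobi lam mu d h k l m :
  kernel mu (lam + d) l m (fun n => kernel lam d k n h) =
  kernel lam (- lam - mu) k l (fun n => kernel (lam + mu) d n m h)
  + kernel lam (mu + d) k m (fun n => kernel mu d l n h).
Proof.
case: k l m => [al i] [be j] [ga k].
(* The three ways of adding the indices get one name, so that [ring] sees the same values of [h] in
   all terms. *)
have [w [w1 w2 w3]] :
    exists w, [/\ al + be + ga = w, al + (be + ga) = w & be + (al + ga) = w].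
  by exists (al + be + ga); rewrite addrA addrCA addrA.
(* The cases are needed only for x_(alpha,-1) = 0 to be computed. *)
by case: i j k => [|i] [|j] [|k];
  rewrite /kernel /= ?(addn0, add0n, addnS, addSn, addnA) /=
    ![phi (_ + _)]raddfD !(w1, w2, w3) ?(addnC j i); ring.
Qed.

Lemma pair0_kernel lam d d' k l (F : G -> G -> B) (u : M) :
  kernel lam d k l (fun n => pair0 iota d' (F n) u)
  = pair0 iota d' (fun m => kernel lam d k l (fun n => F n m)) u.
Proof.
rewrite /kernel /pair0 mmap_coefD !mmap_coefM; congr (_ + _ * _).
by rewrite /at_pred; case: addn => [|n] //; rewrite mmap_coef0.
Qed.

End CL3Pairing.

(** * The Lie conformal axioms *)

Section CL3LieConformal.
Variables (K : fieldType) (Delta : zmodClosed K).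
Variables (b : K) (phi : {additive subgroup Delta -> K}) (c : K).
Local Notation M := (cl3 Delta).
Local Notation br := (cl3_br b phi c).

Section Triple.
Variables (B : comNzRingType) (iota : {rmorphism K -> B}) (lam mu d : B).
Variable (h : (subgroup Delta * nat)%type -> B).
Local Notation ker := (kernel b phi c iota).

Lemma pair2_subst2 (f : M -> M[lambda]) (p : M[lambda]) S T s t :
    (forall q, pair2 iota lam mu d h (S q) = s * pair2 iota lam mu d h q) ->
    (forall q, pair2 iota lam mu d h (T q) = t * pair2 iota lam mu d h q) ->
  pair2 iota lam mu d h (subst S (fun m => subst T (@const2 K M) (f m)) p)
  = mmap (fun m => pair1 iota t d h (f m)) (fun n => s ^+ n) p.
Proof.
move=> HS HT; transitivity
  (mmap (fun m => pair2 iota lam mu d h (subst T (@const2 K M) (f m)))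
        (fun n => s ^+ n) p).
  exact: (subst_mmap (F := pair2 iota lam mu d h)).
by apply: eq_mmap => // m; apply: pair2_subst.
Qed.

(** Here [v_mu w] is a right argument, hence paired at lambda + d; its own right argument [w] is
    then paired at mu + (lambda + d). The next two lemmas reach the same three values for [u], [v]
    and [w], which lets the Jacobi identity be checked kernel by kernel. *)
Lemma pair2_lambda_mu (u v w : M) :
  pair2 iota lam mu d h (br_lambda_mu br u v w) =
  pair0 iota (- lam) (fun k => pair0 iota (- mu) (fun l =>
    pair0 iota (lam + mu + d) (fun m =>
      ker mu (lam + d) l m (fun n => ker lam d k n h)) w) v) u.
Proof.
transitivity (mmap (fun m => pair1 iota lam d h (br u m))
                   (fun n => mu ^+ n) (br v w)).
  by apply: pair2_subst2; [apply: pair2_mu | apply: pair2_lambda].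
under eq_mmap => [m|n] do [rewrite pair1_br|over].
rewrite /pair0 mmap_exchangel; apply: eq_mmap => // k.
by rewrite -/(pair1 iota mu (lam + d) _ _) pair1_br addrCA addrA.
Qed.

Lemma pair2_sum (u v w : M) :
  pair2 iota lam mu d h (br_sum br u v w) =
  pair0 iota (- lam) (fun k => pair0 iota (- mu) (fun l =>
    pair0 iota (lam + mu + d) (fun m =>
      ker lam (- lam - mu) k l (fun n => ker (lam + mu) d n m h)) w) v) u.
Proof.
transitivity (pair1 iota lam (- lam - mu)
    (fun n => pair0 iota (lam + mu + d) (fun m => ker (lam + mu) d n m h) w)
    (br u v)).
  rewrite -opprD.
  transitivity (mmap (fun m => pair1 iota (lam + mu) d h (br m w))
                     (fun n => lam ^+ n) (br u v)).
    apply: pair2_subst2 => [|q]; first exact: pair2_lambda.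
    by rewrite raddfD /= pair2_lambda pair2_mu mulrDl.
  by apply: eq_mmap => // m; apply: pair1_br.
rewrite pair1_br; apply: eq_mmap => // k.
(* As right argument of a bracket that itself sits on the left, [v] sees lambda plus the value -
   lambda - mu of d. *)
have -> : lam + (- lam - mu) = - mu by ring.
by apply: eq_mmap => // l; apply: pair0_kernel.
Qed.

Lemma pair2_mu_lambda (u v w : M) :
  pair2 iota lam mu d h (br_mu_lambda br u v w) =
  pair0 iota (- lam) (fun k => pair0 iota (- mu) (fun l =>
    pair0 iota (lam + mu + d) (fun m =>
      ker lam (mu + d) k m (fun n => ker mu d l n h)) w) v) u.
Proof.
transitivity (mmap (fun m => pair1 iota mu d h (br v m))
                   (fun n => lam ^+ n) (br u w)).
  by apply: pair2_subst2; [apply: pair2_lambda | apply: pair2_mu].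
under eq_mmap => [m|n] do [rewrite pair1_br|over].
rewrite /pair0 mmap_exchangel [RHS]mmap_exchange; apply: eq_mmap => // l.
by rewrite -/(pair1 iota lam (mu + d) _ _) pair1_br addrA.
Qed.

Lemma pair2_jacobi (u v w : M) :
  pair2 iota lam mu d h (br_lambda_mu br u v w) =
  pair2 iota lam mu d h (br_sum br u v w + br_mu_lambda br u v w).
Proof.
rewrite raddfD /= pair2_lambda_mu pair2_sum pair2_mu_lambda /pair0 -mmap_coefD.
apply: eq_mmap => // k; rewrite -mmap_coefD; apply: eq_mmap => // l.
by rewrite -mmap_coefD; apply: eq_mmap => // m; apply: kernel_jacobi.
Qed.

End Triple.

Lemma pair0_affine (B : comNzRingType) (iota : {rmorphism K -> B}) d h
    (t : K) (u v : M) :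
  pair0 iota d h (t%:P *: u + v)
  = iota t * pair0 iota d h u + pair0 iota d h v.
Proof. by rewrite raddfD /= [X in X + _ = _]pair0Z evC. Qed.

Lemma pair1_affine (B : comNzRingType) (iota : {rmorphism K -> B}) lam d h
    (t : K) (p q : M[lambda]) :
  pair1 iota lam d h (t%:P *: p + q)
  = iota t * pair1 iota lam d h p + pair1 iota lam d h q.
Proof. by rewrite raddfD /= [X in X + _ = _]pair1Z evC. Qed.

Lemma pair1_flip (B : comNzRingType) (iota : {rmorphism K -> B}) lam d h
    (u v : M) :
  pair1 iota lam d h (br_flip br u v) = pair1 iota (- lam - d) d h (br v u).
Proof.
transitivity (mmap (fun m => pair1 iota lam d h (@const1 K M m))
                   (fun n => (- lam - d) ^+ n) (br v u)).
  apply: (subst_mmap (F := pair1 iota lam d h)) => p.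
  by rewrite raddfB raddfN /= pair1_lambda [X in _ - X = _]pair1_d mulrBl mulNr.
by apply: eq_mmap => // m; apply: pair1_const.
Qed.

Lemma cl3_lie_conformal : lie_conformal_algebra br.
Proof.
split=> [t u u' v|t u v v'|u v|u v|u v|u v w].
- apply: pair1_inj => h.
  rewrite [RHS]pair1_affine [LHS]pair1_br
    [X in _ * X + _]pair1_br [X in _ = _ + X]pair1_br.
  exact: pair0_affine.
- apply: pair1_inj => h.
  rewrite [RHS]pair1_affine [LHS]pair1_br
    [X in _ * X + _]pair1_br [X in _ = _ + X]pair1_br.
  rewrite /pair0 -mmap_coefM -mmap_coefD; apply: eq_mmap => // k.
  exact: pair0_affine.
- apply: pair1_inj => h.
  rewrite raddfN /= [X in - X]pair1_lambda [LHS]pair1_br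
    [X in _ * X]pair1_br.
  by rewrite [LHS]pair0Z evX mulNr.
- apply: pair1_inj => h.
  rewrite raddfD /=.
  rewrite [X in X + _]pair1_lambda [X in _ + X]pair1_d -mulrDl
    [LHS]pair1_br [X in _ * X]pair1_br.
  rewrite /pair0 -mmap_coefM; apply: eq_mmap => // k.
  by rewrite [LHS]pair0Z evX.
- apply: pair1_inj => h.
  rewrite raddfN /= pair1_flip [LHS]pair1_br [X in _ = - X]pair1_br.
  (* Replacing lambda by - lambda - d exchanges the values - lambda and lambda + d of the two
     arguments. *)
  rewrite subrK opprB opprK ['Y + _]addrC /pair0 mmap_exchange.
  rewrite -[RHS]mulN1r -mmap_coefM; apply: eq_mmap => // l.
  rewrite -mmap_coefM; apply: eq_mmap => // k.
  by rewrite mulN1r; apply: kernel_skew.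
- by apply: pair2_inj => h; apply: pair2_jacobi.
Qed.

End CL3LieConformal.

(** * The commutative algebra A and its derivation D *)

Section LinearExtension.
Variables (K : fieldType) (I : choiceType) (V : lmodType K) (f : I -> V).

Definition linext (y : {malg K[I]}) : V := \sum_(k <- msupp y) y@_k *: f k.

Lemma linextEw (d : {fset I}) (y : {malg K[I]}) : (msupp y `<=` d)%fset ->
  linext y = \sum_(k <- d) y@_k *: f k.
Proof.
move=> le_yd; rewrite /linext (big_fset_incl _ le_yd) // => k _.
by move/mcoeff_outdom ->; rewrite scale0r.
Qed.

Lemma linext_is_linear : linear linext.
Proof.
move=> t x y; pose d := (msupp (t *: x + y) `|` (msupp x `|` msupp y))%fset.
rewrite !(@linextEw d) /d ?fsubsetUl //; last first.
- by rewrite fsubsetU // fsubsetUl orbT.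
- by rewrite fsubsetU // fsubsetUr orbT.
rewrite scaler_sumr -big_split; apply: eq_bigr => k _ /=.
by rewrite mcoeffD mcoeffZ scalerDl scalerA.
Qed.

HB.instance Definition _ := GRing.isLinear.Build K {malg K[I]} V _ linext
  linext_is_linear.

Lemma linextX k : linext << k >> = f k.
Proof. by rewrite /linext msuppU oner_eq0 big_seq_fset1 mcoeffUU scale1r. Qed.

End LinearExtension.

Lemma malgU_scale (K : fieldType) (I : choiceType) (t : K) (k : I) :
  << t *g k >> = t *: << k >> :> {malg K[I]}.
Proof. by apply/malgP => l; rewrite [RHS]mcoeffZ !mcoeffU mulr_natr. Qed.

Lemma malg_gen (K : fieldType) (I : choiceType) (y : {malg K[I]}) :
  y = \sum_(k <- msupp y) y@_k *: << k >>.
Proof.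
by rewrite {1}(monalgE y); apply: eq_bigr => k _; apply: malgU_scale.
Qed.

Lemma malg_lin_ind (K : fieldType) (I : choiceType) (P : {malg K[I]} -> Prop) :
    P 0 -> (forall t k y, P y -> P (t *: << k >> + y)) -> forall y, P y.
Proof.
by move=> P0 PD y; rewrite (malg_gen y); elim/big_rec: _ => // k x _; apply: PD.
Qed.

Lemma malg_linear_ext (K : fieldType) (I : choiceType) (V : lmodType K)
    (f g : {linear {malg K[I]} -> V}) :
  (forall k, f << k >> = g << k >>) -> f =1 g.
Proof.
move=> fg y; rewrite (malg_gen y) !linear_sum; apply: eq_bigr => k _.
by rewrite !linearZ fg.
Qed.

Lemma mcoeff_affine (K : fieldType) (I : choiceType) (t : K)
    (x y : {malg K[I]}) k : (t *: x + y)@_k = t * x@_k + y@_k.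
Proof. by rewrite mcoeffD mcoeffZ. Qed.

(** * Products of the commuting operators f - a *)

Section Annihilator.
Variables (K : fieldType) (V : lmodType K) (f : {linear V -> V}).

Definition op_sub (a : K) (v : V) : V := f v - a *: v.

Lemma op_sub_is_linear a : linear (op_sub a).
Proof.
move=> t u v; rewrite /op_sub linearP scalerDr !scalerA [a * t]mulrC -scalerA.
by rewrite opprD addrACA scalerBr.
Qed.
HB.instance Definition _ a := GRing.isLinear.Build K V V _ (op_sub a)
  (op_sub_is_linear a).

Lemma op_subC a a' v : op_sub a (op_sub a' v) = op_sub a' (op_sub a v).
Proof.
rewrite /op_sub !(linearB f) !(linearZ_LR f) /= !scalerBr !scalerA !opprB.
rewrite [a' * a]mulrC -!addrA; congr (_ + _).
by rewrite addrCA [RHS]addrCA; congr (_ + _); rewrite addrC.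
Qed.

Definition op_prod (s : seq K) (v : V) : V := foldr op_sub v s.

Lemma op_prod_cons a s v : op_prod (a :: s) v = op_sub a (op_prod s v).
Proof. by []. Qed.

Lemma op_prod_is_linear s : linear (op_prod s).
Proof.
by elim: s => // a s IHs t u v; rewrite !op_prod_cons IHs linearP.
Qed.
HB.instance Definition _ s := GRing.isLinear.Build K V V _ (op_prod s)
  (op_prod_is_linear s).

Lemma op_prodP s t u v :
  op_prod s (t *: u + v) = t *: op_prod s u + op_prod s v.
Proof. exact: op_prod_is_linear. Qed.

Lemma op_prodZ s t v : op_prod s (t *: v) = t *: op_prod s v.
Proof. exact: linearZ. Qed.

Lemma op_prod_sub s a v : op_prod s (op_sub a v) = op_sub a (op_prod s v).
Proof. by elim: s => // a' s IHs; rewrite !op_prod_cons IHs op_subC. Qed.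

Lemma op_prodC s s' v : op_prod s (op_prod s' v) = op_prod s' (op_prod s v).
Proof. by elim: s => // a s IHs; rewrite !op_prod_cons IHs op_prod_sub. Qed.

Lemma op_prod_cat s s' v : op_prod (s ++ s') v = op_prod s (op_prod s' v).
Proof. exact: foldr_cat. Qed.

End Annihilator.

(** * Local finiteness and eigenvectors of D *)

Section Derivation.
Variables (K : fieldType) (Delta : zmodClosed K).
Hypothesis charK : [pchar K] =i pred0.
Local Notation G := (subgroup Delta * nat)%type.
Local Notation A := {malg K[G]}.
Implicit Types (k l : G) (x y : A).

(* x_(alpha,i) is encoded as << (alpha, i) >>, and [shift k] is the           *)
(* multiplication of A by the generator k.                                    *)
Definition gpred k : A := if k.2 is i.+1 then << (k.1, i) >> else 0.

Definition shift k : A -> A :=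
  linext (fun l => << (k.1 + l.1, (k.2 + l.2)%N) >> : A).
HB.instance Definition _ k := GRing.Linear.on (shift k).

Definition der : A -> A :=
  linext (fun k => sgval k.1 *: << k >> + k.2%:R *: gpred k : A).
HB.instance Definition _ := GRing.Linear.on der.

Lemma shiftX k l : shift k << l >> = << (k.1 + l.1, (k.2 + l.2)%N) >>.
Proof. exact: linextX. Qed.

Lemma derX k : der << k >> = sgval k.1 *: << k >> + k.2%:R *: gpred k.
Proof. exact: linextX. Qed.

Lemma shift_shift k l y :
  shift k (shift l y) = shift (k.1 + l.1, (k.2 + l.2)%N) y.
Proof.
apply: (malg_linear_ext (f := shift k \o shift l)) => m /=.
by rewrite !shiftX /= addrA addnA.
Qed.

Lemma shift0 y : shift (0, 0%N) y = y.
Proof.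
apply: (malg_linear_ext (g := idfun)) => -[al i] /=.
by rewrite shiftX /= add0r add0n.
Qed.

Lemma mcoeff_der y al i :
  (der y)@_(al, i) = sgval al * y@_(al, i) + i.+1%:R * y@_(al, i.+1).
Proof.
elim/malg_lin_ind: y => [|t [be j] y IHy].
  by rewrite linear0 !mcoeff0 !mulr0 addr0.
rewrite (linearP der) /= !mcoeff_affine [X in _ + X = _]IHy derX
  mcoeff_affine.
rewrite [(_ *: gpred _)@_ _]mcoeffZ !mcoeffU.
have -> : (gpred (be, j))@_(al, i) = ((be, j) == (al, i.+1))%:R.
  by case: j => [|j];
    rewrite /gpred /= ?mcoeff0 ?mcoeffU xpair_eqE ?andbF ?eqSS.
rewrite !xpair_eqE.
case: (be =P al) => [->|_] /=; last by ring.
have -> : j%:R * (j == i.+1)%:R = i.+1%:R * (j == i.+1)%:R :> K.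
  by case: eqP => [->|_]; rewrite ?mulr0.
by ring.
Qed.

(** On e^(alpha t) t^i the operator D - alpha differentiates only the factor t^i, so i + 1
    applications give 0. *)
Lemma der_prodX al i : op_prod der (nseq i.+1 (sgval al)) << (al, i) >> = 0.
Proof.
elim: i => [|i IHi]; first by rewrite /= /op_sub /= derX scale0r addr0 subrr.
have subX : op_sub der (sgval al) << (al, i.+1) >> = i.+1%:R *: << (al, i) >>.
  by rewrite /op_sub /= derX addrAC subrr add0r.
have := op_prod_sub der (nseq i.+1 (sgval al)) (sgval al) << (al, i.+1) >>.
by rewrite subX -op_prod_cons => <-; rewrite op_prodZ IHi scaler0.
Qed.

(** The lists killing the monomials of [y] are concatenated; as the factors commute, each block
    still kills its own monomial. *)
Lemma der_prod_ann y : exists s, op_prod der s y = 0.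
Proof.
elim/malg_lin_ind: y => [|t [al i] x [s xs]]; first by exists [::].
exists (nseq i.+1 (sgval al) ++ s); rewrite op_prod_cat op_prodP xs addr0.
by rewrite op_prodZ op_prodC der_prodX linear0 scaler0.
Qed.

(** Comparing coefficients gives (alpha - a) y_(alpha,i) + (i + 1) y_(alpha,i+1) = 0. This forces
    the support of [y] into the single index (alpha, 0) with alpha = a. *)
Lemma der_eigen a y : op_sub der a y = 0 -> y != 0 ->
  exists al t, t != 0 /\ y = t *: << (al, 0%N) >>.
Proof.
move=> ya y0.
have coefE al i : (sgval al - a) * y@_(al, i) + i.+1%:R * y@_(al, i.+1) = 0.
  have := congr1 (mcoeff (al, i)) ya; rewrite mcoeffB mcoeffZ mcoeff_der.
  by rewrite mcoeff0 => <-; ring.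
have [n yn] : exists n, forall al i, (n <= i)%N -> y@_(al, i) = 0.
  exists (\max_(k <- msupp y) k.2).+1 => al i lt_i; apply: mcoeff_outdom.
  apply/negP => yi; move: lt_i; rewrite ltnNge => /negP; apply.
  exact: (@leq_bigmax_seq _ (enum_fset (msupp y)) xpredT
            (fun k : G => k.2) (al, i) yi isT).
(* Descending induction on [i], starting from the bound [n] beyond which the coefficients vanish. *)
have off al i : sgval al != a -> y@_(al, i) = 0.
  move=> ala; have [m] := ubnP (n - i); elim: m i => // m IHm i lt_m.
  have [/yn->//|lt_in] := leqP n i.
  have := coefE al i; rewrite (IHm i.+1); last first.
    by rewrite ltnS in lt_m; apply: leq_trans lt_m; apply: ltn_sub2l.
  by rewrite mulr0 addr0 => /eqP; rewrite mulf_eq0 subr_eq0 (negPf ala) => /eqP.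
(* Only the term with factor i + 1 survives, and i + 1 is nonzero in characteristic 0. *)
have on al i : sgval al = a -> y@_(al, i.+1) = 0.
  move=> ala; have /eqP := coefE al i; rewrite ala subrr mul0r add0r.
  by rewrite mulf_eq0 (iffLR (pcharf0P K) charK) => /eqP.
have [|ynz] := altP (msupp y =P fset0).
  move=> y_eq0; case/eqP: y0; apply/malgP => k; rewrite mcoeff0.
  by rewrite mcoeff_outdom // y_eq0.
have /fset0Pn[[al i]] := ynz; rewrite -mcoeff_neq0 => yk.
have ala : sgval al = a.
  by apply/eqP/negPn/negP => /(off _ i) yi; rewrite yi eqxx in yk.
case: i yk => [|i] yk; last by rewrite on ?eqxx in yk.
exists al, (y@_(al, 0%N)); split=> //; apply/malgP => -[be j].
rewrite mcoeffZ mcoeffU xpair_eqE.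
have [<-|al_be] := al =P be; last first.
  rewrite mulr0 off //; apply/eqP => be_a; apply: al_be; apply: val_inj.
  by rewrite /= ala be_a.
by case: j => [|j]; rewrite ?mulr1 // mulr0 on.
Qed.

End Derivation.

(** * Simplicity *)

Section LambdaCoefficients.
Variables (K : fieldType) (M : lmodType {poly K}).
Implicit Types (p : M[lambda]) (m : M).

Definition lambda_d p : M[lambda] := mul_lambda p + mul_d p.

Lemma mcoeff_polyZ (f : {poly K}) p n : (f *: p)@_n = f *: p@_n.
Proof. exact: pscaleE. Qed.

Lemma mcoeff_lambda p n : (mul_lambda p)@_n.+1 = p@_n.
Proof.
rewrite /mul_lambda /Defs.reindex raddf_sum [in RHS](monalgE p) raddf_sum.
by apply: eq_bigr => k _; rewrite /= !mcoeffU.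
Qed.

Lemma mcoeff_lambda_d p n :
  (lambda_d p)@_n.+1 = p@_n + 'X *: p@_n.+1.
Proof. by rewrite mcoeffD mcoeff_lambda mcoeff_polyZ. Qed.

Lemma mcoeff_iter_lambda_d p N n : (forall i, p@_i.+2 = 0) ->
  (iter N lambda_d p)@_(N + n.+1)%N = p@_n.+1.
Proof.
move=> p_deg; elim: N n => [//|N IHN] n.
by rewrite addSn /= mcoeff_lambda_d IHN -addnS IHN p_deg scaler0 addr0.
Qed.

(** As [p] has degree at most 1 in lambda, lambda^(N+1) in f(lambda + d) p arises only from f_N
    lambda^N times the linear term of [p]. *)
Lemma mcoeff_op_eval (f : {poly K}) p N :
    (forall i, p@_i.+2 = 0) -> (size f <= N.+1)%N ->
  (op_eval f lambda_d p)@_N.+1 = (f`_N)%:P *: p@_1.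
Proof.
move=> p_deg le_fN; rewrite /op_eval.
pose F n : M[lambda] := (f`_n)%:P *: iter n lambda_d p.
(* The sum is extended to [N.+1] terms, since [f] may have degree below [N]; the last term is the
   only one that reaches lambda^(N+1). *)
rewrite (big_ord_widen _ F le_fN) big_mkcond big_ord_recr /= mcoeffD raddf_sum.
rewrite big1 ?add0r => [|n _ /=]; last first.
  case: ifP => _; last exact: mcoeff0.
  move: {n}(n : nat) (ltn_ord n) => n lt_nN.
  have -> : N.+1 = (n + (N - n.+1).+2)%N by rewrite !addnS -addSn subnKC.
  by rewrite mcoeff_polyZ mcoeff_iter_lambda_d // p_deg scaler0.
rewrite /F; case: ltnP => [_|/(nth_default 0) ->].
  by rewrite mcoeff_polyZ -addn1 mcoeff_iter_lambda_d.
by rewrite scale0r mcoeff0.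
Qed.

End LambdaCoefficients.

Section MapMalg.
Variables (I : choiceType) (M N : zmodType) (f : {additive M -> N}).

Definition map_malg (u : {malg M[I]}) : {malg N[I]} :=
  \sum_(k <- msupp u) << f u@_k *g k >>.

Lemma mcoeff_map u k : (map_malg u)@_k = f u@_k.
Proof.
rewrite [in RHS](monalgE u) !raddf_sum; apply: eq_bigr => l _ /=.
by rewrite !mcoeffU raddfMn.
Qed.

End MapMalg.

Section CL3Simple.
Variables (K : fieldType) (Delta : zmodClosed K).
Hypothesis charK : [pchar K] =i pred0.
Variables (b : K) (phi : {additive subgroup Delta -> K}) (c : K).
Local Notation G := (subgroup Delta * nat)%type.
Local Notation A := {malg K[G]}.
Local Notation MG := {malg {poly K}[G]}.
Local Notation M := (cl3 Delta).
Local Notation br := (cl3_br b phi c).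

Definition emb (y : A) : M := map_malg polyC y.
Definition top_coef N (u : M) : A := map_malg (coefp N) (u : MG).

Lemma mcoeff_emb y k : (emb y : MG)@_k = (y@_k)%:P.
Proof. exact: mcoeff_map. Qed.

Lemma mcoeff_top_coef N u k : (top_coef N u)@_k = ((u : MG)@_k)`_N.
Proof. exact: mcoeff_map. Qed.

Lemma emb_affine t x y : emb (t *: x + y) = t%:P *: emb x + emb y.
Proof.
apply/malgP => k; rewrite [LHS]mcoeff_emb mcoeff_affine [RHS]mcoeffD.
by rewrite [X in _ = _ + X]mcoeff_emb [X in _ = X + _]mcoeffZ mcoeff_emb
  polyCD polyCM.
Qed.

Lemma emb0 : emb 0 = 0.
Proof. by apply/malgP => k; rewrite [LHS]mcoeff_emb mcoeff0 [RHS]mcoeff0. Qed.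

Lemma emb_eq0 y : emb y = 0 -> y = 0.
Proof.
move=> y0; apply/malgP => k; apply: polyC_inj; rewrite -mcoeff_emb y0.
by rewrite [LHS]mcoeff0 mcoeff0.
Qed.

Lemma embX k : emb << k >> = cl3_x k.1 k.2.
Proof.
apply/malgP => l; rewrite [LHS]mcoeff_emb /cl3_x -surjective_pairing.
by rewrite [RHS]mcoeffU mcoeffU raddfMn.
Qed.

Lemma emb_gpred k : emb (gpred k) = cl3_xpred k.1 k.2.
Proof. by case: k => al [|i]; [exact: emb0 | exact: embX]. Qed.

Lemma top_coef_emb y : top_coef 0 (emb y) = y.
Proof. by apply/malgP => k; rewrite mcoeff_top_coef (mcoeff_emb y k) coefC. Qed.

(* D + 2b *)
Definition twist (y : A) : A := der y + (b *+ 2) *: y.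

Lemma twist_affine t x y : twist (t *: x + y) = t *: twist x + twist y.
Proof.
by rewrite /twist linearP !scalerDr addrACA !scalerA [(_ *+ 2) * t]mulrC.
Qed.

(** This is the coefficient of lambda in [x_k _lambda y] for y in A. *)
Definition theta k (y : A) : M := emb (twist (shift k y)).

Lemma theta_affine k t x y :
  theta k (t *: x + y) = t%:P *: theta k x + theta k y.
Proof. by rewrite /theta linearP twist_affine emb_affine. Qed.

Lemma theta0 k : theta k 0 = 0.
Proof. by rewrite /theta /twist !linear0 addr0 emb0. Qed.

Lemma theta_sum k (r : seq G) (t : G -> K) :
  theta k (\sum_(l <- r) << t l *g l >>)
  = \sum_(l <- r) (t l)%:P *: theta k << l >>.
Proof.
elim: r => [|l r IHr]; first by rewrite !big_nil theta0.
have -> : \sum_(m <- l :: r) << t m *g m >>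
    = t l *: << l >> + \sum_(m <- r) << t m *g m >> :> A.
  by rewrite big_cons malgU_scale.
by rewrite theta_affine IHr [RHS]big_cons.
Qed.

(** The trailing [+ 0] lets [emb_affine] be applied twice. *)
Lemma twistX k :
  twist << k >> = (sgval k.1 + b *+ 2) *: << k >> + (k.2%:R *: gpred k + 0).
Proof.
have comb (x y : A) (s t : K) : s *: x + y + t *: x = (s + t) *: x + (y + 0).
  by rewrite addr0 addrAC scalerDl.
by rewrite /twist derX; apply: comb.
Qed.

Lemma emb_twistX k : emb (twist << k >>) =
  (sgval k.1 + b *+ 2)%:P *: cl3_x k.1 k.2 + k.2%:R%:P *: cl3_xpred k.1 k.2.
Proof.
by rewrite twistX 2!emb_affine emb0 [X in _ + X = _]addr0 embX emb_gpred.
Qed.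

Lemma mcoeff_gen k l n :
  (cl3_br_gen b phi c k.1 k.2 l.1 l.2)@_n.+1 =
  if n == 0%N then theta k << l >> else 0.
Proof.
rewrite /cl3_br_gen 3!mcoeffD [X in X + _ + _ + _]mcoeff_polyZ.
rewrite [X in _ + X + _ + _]mcoeff_lambda [X in _ + X + _]mcoeff_polyZ.
rewrite [X in _ + _ + X]mcoeff_polyZ !mcoeffU /= !scaler0 add0r !addr0.
by case: n => // ; rewrite /theta shiftX emb_twistX.
Qed.

(** A bracket of generators has degree 1 in lambda with linear coefficient [theta], so only the d^N
    part of [u] contributes to lambda^(N+1). *)
Lemma br_x_coef k (u : M) N :
    (forall l, size ((u : MG)@_l) <= N.+1)%N ->
  (br (cl3_x k.1 k.2) u)@_N.+1 = theta k (top_coef N u).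
Proof.
move=> u_deg; rewrite /cl3_br /cl3_x !msuppU oner_eq0 !big_seq_fset1.
rewrite mcoeffUU raddf_sum /=.
transitivity
  (\sum_(l <- msupp (u : MG)) (((u : MG)@_l)`_N)%:P *: theta k << l >>).
  apply: eq_bigr => l _.
  rewrite {1}/op_eval size_poly1 big_ord1 /= -polyC1 coefC /= scale1r.
  rewrite [LHS](mcoeff_op_eval (M := cl3 Delta)) ?mcoeff_gen //.
  by move=> i; rewrite mcoeff_gen.
rewrite /top_coef /map_malg.
by rewrite theta_sum.
Qed.

(** * The D-stable ideal of A attached to an ideal of the conformal algebra *)

Section Ideal.
Variable J : M -> Prop.
Hypothesis idJ : ideal br J.

Lemma ideal_affine (f : {poly K}) u v : J u -> J v -> J (f *: u + v).
Proof. by case: idJ => -[_ JP] _; apply: JP. Qed.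

Lemma ideal0 : J 0.
Proof. by case: idJ => -[]. Qed.

Lemma ideal_br u v n : J v -> J (br u v)@_n.
Proof.
case: idJ => _ + Jv; apply; exists 1%N, (fun=> 1), (fun=> (br u v)@_n).
by split=> [_|]; [exists u, v, n | rewrite big_ord1 polyC1 scale1r].
Qed.

Definition absorbed (y : A) : Prop := forall k, J (theta k y).

Lemma absorbed_affine t x y :
  absorbed x -> absorbed y -> absorbed (t *: x + y).
Proof. by move=> Yx Yy k; rewrite theta_affine; apply: ideal_affine. Qed.

Lemma absorbed0 : absorbed 0.
Proof. by move=> k; rewrite theta0; apply: ideal0. Qed.

Lemma absorbed_top_coef u N :
  (forall l, size ((u : MG)@_l) <= N.+1)%N -> J u -> absorbed (top_coef N u).
Proof. by move=> u_deg Ju k; rewrite -br_x_coef //; apply: ideal_br. Qed.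

Lemma absorbed_emb y : J (emb y) -> absorbed y.
Proof.
move=> Jy; rewrite -[y]top_coef_emb; apply: absorbed_top_coef => [l|//].
by rewrite (mcoeff_emb y l) size_polyC_leq1.
Qed.

Lemma absorbed_shift k y : absorbed y -> absorbed (shift k y).
Proof. by move=> Yy l; rewrite /theta shift_shift; apply: Yy. Qed.

(** Multiplying by the unit of A puts (D + 2b) y itself in [J]; having d-degree 0 it is absorbed,
    and subtracting 2b y leaves D y. *)
Lemma absorbed_der y : absorbed y -> absorbed (der y).
Proof.
have comb (V : lmodType K) (x z : V) (t : K) : x = (- t) *: z + (x + t *: z).
  by rewrite addrCA -scalerDl addNr scale0r addr0.
move=> Yy; rewrite (comb _ (der y) y (b *+ 2)) -/(twist y).
apply: (absorbed_affine _ Yy); apply: absorbed_emb.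
by have := Yy (0, 0%N); rewrite /theta shift0.
Qed.

Lemma absorbed_op_sub a y : absorbed y -> absorbed (op_sub (@der K Delta) a y).
Proof.
have comb (V : lmodType K) (x z : V) : x - a *: z = (- a) *: z + x.
  by rewrite addrC scaleNr.
move=> Yy; rewrite /op_sub comb.
exact: (absorbed_affine _ Yy (absorbed_der Yy)).
Qed.

(** The factors of an annihilating product are applied to [y] one at a time; the last nonzero vector
    before 0 appears is an eigenvector of D and is still absorbed. *)
Lemma absorbed_eigen y : absorbed y -> y != 0 ->
  exists al t, t != 0 /\ absorbed (t *: << (al, 0%N) >>).
Proof.
move=> Yy y0; have [s] := der_prod_ann y.
elim: s y Yy y0 => [|a s IHs] y Yy y0.
  by move=> /= y_eq0; rewrite y_eq0 eqxx in y0.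
rewrite op_prod_cons -op_prod_sub => ys.
have [ya|ya] := eqVneq (op_sub (@der K Delta) a y) 0.
  have [al [t [t0 y_eq]]] := der_eigen charK ya y0.
  exists al, t; split; first exact: t0.
  by rewrite -y_eq.
exact: IHs (absorbed_op_sub a Yy) ya ys.
Qed.

Lemma absorbed_one y : absorbed y -> y != 0 -> absorbed << (0, 0%N) >>.
Proof.
move=> Yy /(absorbed_eigen Yy) [al [t [t0 Yt]]].
(* The eigenvector e^(alpha t) is a unit of A, with inverse e^(- alpha t). *)
have /(absorbed_shift (- al, 0%N)) : absorbed << (al, 0%N) >>.
  have unscale (V : lmodType K) (x : V) : x = t^-1 *: (t *: x) + 0.
    by rewrite addr0 scalerA mulVf // scale1r.
  rewrite (unscale _ << (al, 0%N) >>).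
  exact: absorbed_affine Yt absorbed0.
by rewrite shiftX /= addNr addn0.
Qed.

(** This is the surjectivity of D + 2b. It sends x_(alpha,j) to (alpha + 2b) x_(alpha,j) + j
    x_(alpha,j-1): if alpha + 2b = 0, then j = i + 1 yields x_(alpha,i) up to a nonzero integer;
    otherwise induction on i applies. *)
Lemma ideal_x : absorbed << (0, 0%N) >> -> forall k, J (cl3_x k.1 k.2).
Proof.
move=> Y1 [al i] /=.
have JE j :
    J ((sgval al + b *+ 2)%:P *: cl3_x al j + j%:R%:P *: cl3_xpred al j).
  have := Y1 (al, j); rewrite /theta shiftX /= addr0 addn0.
  by rewrite emb_twistX.
have Jcancel (t : K) (u : M) : t != 0 -> J (t%:P *: u) -> J u.
  move=> t0 Ju; have := ideal_affine (t^-1)%:P Ju ideal0.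
  by rewrite addr0 scalerA -polyCM mulVf // polyC1 scale1r.
have [s0|s0] := eqVneq (sgval al + b *+ 2) 0.
  apply: (Jcancel i.+1%:R); first by rewrite (iffLR (pcharf0P K) charK).
  by have := JE i.+1; rewrite s0 scale0r add0r.
elim: i => [|i IHi]; apply: (Jcancel _ _ s0).
  by have := JE 0%N; rewrite scale0r addr0.
have := ideal_affine (- i.+1%:R%:P) IHi (JE i.+1).
by rewrite addrCA scaleNr addNr addr0.
Qed.

Lemma ideal_full : (forall k, J (cl3_x k.1 k.2)) -> forall u, J u.
Proof.
move=> Jx u; rewrite (monalgE (u : MG)).
elim/big_rec: _ => [|k v _ Jv]; first exact: ideal0.
have := ideal_affine (u : MG)@_k (Jx k) Jv; congr J; congr (_ + _).
apply/malgP => l; rewrite [LHS]mcoeffZ /cl3_x -surjective_pairing.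
by rewrite [X in _ * X]mcoeffU [RHS]mcoeffU mulr_natr.
Qed.

Lemma ideal_nonzero u : J u -> u != 0 -> forall v, J v.
Proof.
pose f k : {poly K} := (u : MG)@_k.
have f_out k : k \notin msupp (u : MG) -> f k = 0 by exact: mcoeff_outdom.
pose supp := enum_fset (msupp (u : MG)).
have bounded : exists n, all (fun k => size (f k) <= n)%N supp.
  exists (\max_(k <- supp) size (f k))%N.
  by apply/allP => k uk; apply: (leq_bigmax_seq k).
(* The least bound on the sizes is not 0 because [u] is nonzero; writing it N + 1, N is the d-degree
   of [u], and minimality makes the coefficient of d^N nonzero. *)
move=> Ju u0; case: (ex_minnP bounded) => -[|N] /allP deg_f minN.
  case/eqP: u0; apply/malgP => k; rewrite [RHS]mcoeff0 -/(f k).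
  have [/deg_f|/f_out//] := boolP (k \in msupp (u : MG)).
  by rewrite leqn0 size_poly_eq0 => /eqP.
have u_deg k : (size (f k) <= N.+1)%N.
  have [/deg_f//|/f_out->] := boolP (k \in msupp (u : MG)).
  by rewrite size_poly0.
apply/ideal_full/ideal_x/(absorbed_one (absorbed_top_coef u_deg Ju)).
apply/eqP => top0; suff /minN : all (fun k => size (f k) <= N)%N supp.
  by rewrite ltnn.
apply/allP => k _; apply/leq_sizeP => i.
rewrite leq_eqVlt => /predU1P[<-|]; last exact: (leq_sizeP _ _ (u_deg k)).
by have := congr1 (mcoeff k) top0; rewrite mcoeff_top_coef mcoeff0.
Qed.

End Ideal.

Lemma cl3_simple : b != 0 -> simple_lca br.
Proof.
move=> b0; split=> [ab|J idJ].
  (* The coefficient of lambda in [x_(0,0) _lambda x_(0,0)] is 2b x_(0,0), which is nonzero. *)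
  pose one : A := << (0, 0%N) >>; pose v := (br (cl3_x 0 0) (emb one))@_1.
  have : br_span br setT setT v.
    exists 1%N, (fun=> 1), (fun=> v); split=> [_|].
      by exists (cl3_x 0 0), (emb one), 1%N.
    by rewrite big_ord1 polyC1 scale1r.
  have one_deg l : (size ((emb one : MG)@_l) <= 1)%N.
    by rewrite (mcoeff_emb one l) size_polyC_leq1.
  rewrite ab /v (br_x_coef (0, 0%N) one_deg) top_coef_emb /theta shift0 => v0.
  have := congr1 (mcoeff (0, 0%N)) (emb_eq0 v0).
  rewrite twistX mcoeff_affine mcoeffUU.
  rewrite scale0r addr0 !mcoeff0 addr0 mulr1 add0r => /eqP.
  by rewrite -mulr_natr mulf_eq0 (negPf b0) (iffLR (pcharf0P K) charK).
have [[u [Ju u0]]|noJ] := pselect (exists u, J u /\ u != 0).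
  by right; apply/seteqP; split=> // v _; apply: ideal_nonzero Ju u0 v.
left; apply/seteqP; split=> [u Ju /=|_ ->]; last exact: ideal0.
by apply/eqP/negPn/negP => u0; apply: noJ; exists u.
Qed.

End CL3Simple.

Theorem theorem4p14 (R : realType) (Delta : zmodClosed R[i]) (b c : R[i])
  (phi : {additive subgroup Delta -> R[i]}) :
  b != 0 ->
  lie_conformal_algebra (cl3_br b phi c) /\ simple_lca (cl3_br b phi c).
Proof.
move=> b0; split; first exact: cl3_lie_conformal.
by apply: cl3_simple => //; apply: Num.Theory.pchar_num.
Qed.
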